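(* The theory $\mathrm{TK}$ is Borel complete.
   Context: $\mathrm{TK}$, in multisorted first-order logic (no unsorted elements), has sorts $U$, $V_i$, $C_i$ ($i\in\omega$) and unary functions $S_i,\pi_i^0,\pi_i^1,\tau_{i+1}$ ($i\in\omega$), with axioms: the sorts are disjoint; $U$ and each $V_i$ are infinite and each $C_i$ has size $2^i$; $\tau_{i+1}:C_{i+1}\to C_i$ is a surjection with all fibers of size 2; $\pi_i^1:V_i\to U$ and $\pi_i^0:V_i\to C_i$; writing $\pi_i=\pi_i^0\times\pi_i^1:V_i\to C_i\times U$, every fiber $\pi_i^{-1}(c,u)$ is nonempty; $S_i:V_i\to V_i$ is a successor function (a bijection without finite cycles) with $\pi_i\circ S_i=\pi_i$. $\mathrm{Mod}(\Phi)$ is the set of models of $\Phi$ with universe $\omega$, with the usual Borel structure. $\Phi$ is Borel complete if for every sentence $\Psi$ of $L'_{\omega_1,\omega}$ in a countable language $L'$ there is a Borel map $f:\mathrm{Mod}(\Psi)\to\mathrm{Mod}(\Phi)$ with $M\cong N\iff f(M)\cong f(N)$. *)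

(* Defs.v *)
From Stdlib Require List.
From HB Require Import structures.
From mathcomp Require Import all_boot.
From mathcomp Require Import boolp classical_sets measure.

Set Implicit Arguments.
Unset Strict Implicit.
Unset Printing Implicit Defensive.

Local Open Scope classical_set_scope.

(** * Multisorted languages and L_{omega_1,omega} *)

(* Every language is multisorted; an ordinary language is one with a single
   sort. *)
Record language := Language {
  Sort : countType;
  Fun : countType;
  fdom : Fun -> seq Sort;
  fcod : Fun -> Sort;
  Rel : countType;
  rdom : Rel -> seq Sort
}.

Section Syntax.
Variable L : language.

(* The variable [(s, n)] is the n-th variable of sort [s]. *)
Definition var : Type := (Sort L * nat)%type.

Inductive term : Type :=
| Var of var
| App of Fun L & seq term.

(* [Conj] is the countable conjunction; the other connectives are those of
   (multisorted) first-order logic.  [Exists x] ranges over the elements of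
   the sort of [x]. *)
Inductive formula : Type :=
| Top
| Eq of term & term
| Atom of Rel L & seq term
| Not of formula
| And of formula & formula
| Exists of var & formula
| Conj of (nat -> formula).

Definition Or p q := Not (And (Not p) (Not q)).
Definition Imp p q := Not (And p (Not q)).
Definition Forall x p := Not (Exists x (Not p)).
Definition FinConj (ps : seq formula) := foldr And Top ps.

Definition term_sort (t : term) : Sort L :=
  match t with Var x => x.1 | App f _ => fcod f end.

(* [term_wf X t]: [t] is well-sorted and its variables are in [X]. *)
Fixpoint term_wf (X : seq var) (t : term) : bool :=
  match t with
  | Var x => x \in X
  | App f ts => all (term_wf X) ts && (map term_sort ts == fdom f)
  end.

(* [formula_wf X p]: [p] is well-sorted and its free variables are in [X]. *)
Fixpoint formula_wf (X : seq var) (p : formula) : Prop :=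
  match p with
  | Top => True
  | Eq t u => [&& term_wf X t, term_wf X u & term_sort t == term_sort u]
  | Atom r ts => all (term_wf X) ts && (map term_sort ts == rdom r)
  | Not p => formula_wf X p
  | And p q => formula_wf X p /\ formula_wf X q
  | Exists x p => formula_wf (x :: X) p
  | Conj p => forall n, formula_wf X (p n)
  end.

Definition is_sentence (p : formula) : Prop := formula_wf [::] p.

Fixpoint first_order (p : formula) : bool :=
  match p with
  | Top | Eq _ _ | Atom _ _ => true
  | Not p | Exists _ p => first_order p
  | And p q => first_order p && first_order q
  | Conj _ => false
  end.

(** * Structures with universe omega *)

(* The universe is the disjoint union of the sorts: every element has exactly
   one sort, so there are no unsorted elements.  A function symbol is a
   function on the product of its argument sorts; the value on other arguments
   is junk, fixed to be 0 so that a structure carries no extra information. *)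
Record structure := Structure {
  sort_of : nat -> Sort L;
  funI : Fun L -> seq nat -> nat;
  relI : Rel L -> seq nat -> bool;
  funI_sort : forall f a, map sort_of a = fdom f -> sort_of (funI f a) = fcod f;
  funI_junk : forall f a, map sort_of a <> fdom f -> funI f a = 0;
  relI_sort : forall r a, relI r a -> map sort_of a = rdom r
}.

(* Valuations are not required to respect sorts, because a sort may be empty.
   The truth value of a sentence only involves sort-respecting values, since
   [Exists] does. *)
Definition valuation : Type := var -> nat.

Definition update (e : valuation) (x : var) (a : nat) : valuation :=
  fun y => if y == x then a else e y.

Fixpoint eval (M : structure) (e : valuation) (t : term) : nat :=
  match t with
  | Var x => e x
  | App f ts => funI M f (map (eval M e) ts)
  end.

Fixpoint sat (M : structure) (e : valuation) (p : formula) : Prop :=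
  match p with
  | Top => True
  | Eq t u => eval M e t = eval M e u
  | Atom r ts => relI M r (map (eval M e) ts)
  | Not p => ~ sat M e p
  | And p q => sat M e p /\ sat M e q
  | Exists x p => exists a, sort_of M a = x.1 /\ sat M (update e x a) p
  | Conj p => forall n, sat M e (p n)
  end.

Definition models (M : structure) (p : formula) : Prop := forall e, sat M e p.

Definition iso (M N : structure) : Prop :=
  exists h : nat -> nat,
    [/\ bijective h,
        forall a, sort_of N (h a) = sort_of M a,
        forall f a, map (sort_of M) a = fdom f ->
          funI N f (map h a) = h (funI M f a)
      & forall r a, map (sort_of M) a = rdom r ->
          relI N r (map h a) = relI M r a].

(** * The Borel space of models *)

Definition Mod (T : set formula) : set structure :=
  [set M | forall p, T p -> models M p].

Definition subbasic : set (set structure) :=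
  [set A | [\/ exists a s, A = [set M | sort_of M a = s],
               exists f a b, A = [set M | map (sort_of M) a = fdom f
                                          /\ funI M f a = b]
             | exists r a, A = [set M | relI M r a]]].

Definition borel (T : set formula) : set (set (Mod T)) :=
  <<s [set [set M | A (sval M)] | A in subbasic] >>.

End Syntax.

Arguments Top {L}.

Definition borel_map (L L' : language) (T : set (formula L))
    (T' : set (formula L')) (F : Mod T -> Mod T') : Prop :=
  forall B, borel B -> borel (F @^-1` B).

(* A theory stands for the conjunction of its sentences. *)
Definition borel_complete (L : language) (T : set (formula L)) : Prop :=
  forall (L' : language) (Psi : formula L'), is_sentence Psi ->
  exists F : Mod [set Psi] -> Mod T,
    borel_map F /\
    forall M N, iso (sval M) (sval N)
                <-> iso (sval (F M)) (sval (F N)).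

(** * The theory TK *)

Inductive TK_sort : Type := U | V of nat | C of nat.

(* [tau i] is the map from [C i.+1] to [C i], i.e. the one usually indexed by
   i+1. *)
Inductive TK_fun : Type := Succ of nat | pi0 of nat | pi1 of nat | tau of nat.

Definition TK_sort_code (s : TK_sort) : nat * nat :=
  match s with U => (0, 0) | V i => (1, i) | C i => (2, i) end.
Definition TK_sort_decode (c : nat * nat) : TK_sort :=
  match c with (0, _) => U | (1, i) => V i | (_, i) => C i end.
Lemma TK_sort_codeK : cancel TK_sort_code TK_sort_decode.
Proof. by case. Qed.
HB.instance Definition _ := Countable.copy TK_sort (can_type TK_sort_codeK).

Definition TK_fun_code (f : TK_fun) : nat * nat :=
  match f with
  | Succ i => (0, i) | pi0 i => (1, i) | pi1 i => (2, i) | tau i => (3, i)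
  end.
Definition TK_fun_decode (c : nat * nat) : TK_fun :=
  match c with
  | (0, i) => Succ i | (1, i) => pi0 i | (2, i) => pi1 i | (_, i) => tau i
  end.
Lemma TK_fun_codeK : cancel TK_fun_code TK_fun_decode.
Proof. by case. Qed.
HB.instance Definition _ := Countable.copy TK_fun (can_type TK_fun_codeK).

Definition TK_language : language :=
  {| Sort := TK_sort;
     Fun := TK_fun;
     fdom := fun f => match f with
                      | Succ i | pi0 i | pi1 i => [:: V i]
                      | tau i => [:: C i.+1]
                      end;
     fcod := fun f => match f with
                      | Succ i => V i | pi0 i => C i | pi1 i => U | tau i => C i
                      end;
     Rel := void;
     rdom := fun r => match r with end |}.

Section TKAxioms.

Local Notation frm := (formula TK_language).
Local Notation trm := (term TK_language).

Definition vr (s : TK_sort) (n : nat) : var TK_language := (s, n).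
Definition tv (s : TK_sort) (n : nat) : trm := Var (vr s n).
Definition ap (f : TK_fun) (t : trm) : trm := @App TK_language f [:: t].

Definition at_least (s : TK_sort) (n : nat) : frm :=
  foldr (fun k p => Exists (vr s k) p)
    (FinConj [seq Not (Eq (tv s i) (tv s j)) | j <- iota 0 n, i <- iota 0 j])
    (iota 0 n).

(* Disjointness of the sorts and the sorts of the function symbols are part of
   the multisorted semantics. *)
Inductive TK : frm -> Prop :=
| U_infinite n : TK (at_least U n)
| V_infinite i n : TK (at_least (V i) n)
| C_card i : TK (And (at_least (C i) (2 ^ i))
                     (Not (at_least (C i) (2 ^ i).+1)))
| tau_surj i :
    TK (Forall (vr (C i) 0) (Exists (vr (C i.+1) 0)
         (Eq (ap (tau i) (tv (C i.+1) 0)) (tv (C i) 0))))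
| tau_fibers i :
    let y := tv (C i) 0 in let z := tv (C i.+1) in
    TK (Forall (vr (C i) 0)
         (Exists (vr (C i.+1) 0) (Exists (vr (C i.+1) 1)
           (And (Not (Eq (z 0) (z 1)))
             (Forall (vr (C i.+1) 2)
               (And (Imp (Eq (ap (tau i) (z 2)) y)
                         (Or (Eq (z 2) (z 0)) (Eq (z 2) (z 1))))
                    (Imp (Or (Eq (z 2) (z 0)) (Eq (z 2) (z 1)))
                         (Eq (ap (tau i) (z 2)) y))))))))
| pi_fibers i :
    TK (Forall (vr (C i) 0) (Forall (vr U 0) (Exists (vr (V i) 0)
         (And (Eq (ap (pi0 i) (tv (V i) 0)) (tv (C i) 0))
              (Eq (ap (pi1 i) (tv (V i) 0)) (tv U 0))))))
| S_inj i :
    TK (Forall (vr (V i) 0) (Forall (vr (V i) 1)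
         (Imp (Eq (ap (Succ i) (tv (V i) 0)) (ap (Succ i) (tv (V i) 1)))
              (Eq (tv (V i) 0) (tv (V i) 1)))))
| S_surj i :
    TK (Forall (vr (V i) 0) (Exists (vr (V i) 1)
         (Eq (ap (Succ i) (tv (V i) 1)) (tv (V i) 0))))
| S_acyclic i n :
    TK (Forall (vr (V i) 0)
         (Not (Eq (iter n.+1 (ap (Succ i)) (tv (V i) 0)) (tv (V i) 0))))
| S_pi i :
    TK (Forall (vr (V i) 0)
         (And (Eq (ap (pi0 i) (ap (Succ i) (tv (V i) 0))) (ap (pi0 i) (tv (V i) 0)))
              (Eq (ap (pi1 i) (ap (Succ i) (tv (V i) 0)))
                  (ap (pi1 i) (tv (V i) 0))))).

Lemma TK_first_order_sentence (p : frm) :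
  TK p -> is_sentence p /\ first_order p.
Proof.
have wfC X (ps : seq frm) : (forall q, List.In q ps -> formula_wf X q) ->
    formula_wf X (FinConj ps).
  elim: ps => //= q ps IH H; split; first by apply: H; left.
  by apply: IH => r Hr; apply: H; right.
have foC (ps : seq frm) : (forall q, List.In q ps -> first_order q) ->
    first_order (FinConj ps).
  elim: ps => //= q ps IH H; rewrite H ?IH //; last by left.
  by move=> r Hr; apply: H; right.
have inD s n q :
    List.In q [seq Not (Eq (tv s i) (tv s j)) | j <- iota 0 n, i <- iota 0 j] ->
    exists i j, [/\ i < n, j < n & q = Not (Eq (tv s i) (tv s j))].
  have : all (fun j => j < n) (iota 0 n) by apply/allP => j; rewrite mem_iota.
  elim: (iota 0 n) => //= j js IH /andP[jn /IH{}IH] /List.in_app_iff[|//].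
  have : all (fun i => i < n) (iota 0 j).
    by apply/allP => i; rewrite mem_iota => /ltn_trans; apply.
  elim: (iota 0 j) => //= k ks IHk /andP[kn /IHk{}IHk] [<-|//].
  by exists k, j.
have al s n : is_sentence (at_least s n) /\ first_order (at_least s n).
  rewrite /is_sentence /at_least; set D := FinConj _; split; last first.
    have : first_order D by apply: foC => q /inD[i [j [_ _ ->]]].
    by elim: (iota 0 n).
  have : forall X : seq (var TK_language),
      (forall i, i < n -> (vr s i \in X) || (i \in iota 0 n)) ->
      formula_wf X (foldr (fun k p => Exists (vr s k) p) D (iota 0 n)).
    elim: (iota 0 n) => [|k ks IH] X HX /=.
      apply: wfC => q /inD[i [j [/HX + /HX + ->]]] /=.
      by rewrite !orbF => -> ->; rewrite eqxx.
    apply: IH => i /HX; rewrite !inE => /or3P[iX|/eqP->|iks].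
    - by rewrite iX orbT.
    - by rewrite eqxx.
    - by rewrite iks orbT.
  by apply=> i ltin; apply/orP; right; rewrite mem_iota.
have it i n X : vr (V i) 0 \in X ->
    term_wf X (iter n (ap (Succ i)) (tv (V i) 0)) &&
    (term_sort (iter n (ap (Succ i)) (tv (V i) 0)) == V i).
  move=> iX; elim: n => [|n /andP[wf /eqP so]] /=; first by rewrite iX eqxx.
  by rewrite wf so !eqxx.
case=> [n|i n|i|i|i|i|i|i|i n|i]; try exact: al.
- have [? ?] := al (C i) (2 ^ i); have [? ?] := al (C i) (2 ^ i).+1.
  by split=> //=; apply/andP.
all: split=> //.
all: rewrite /is_sentence /= ?inE ?xpair_eqE ?eqxx ?orbT //=.
have [//|-> /eqP->] := andP (it i n [:: vr (V i) 0] _); first by rewrite inE.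
by rewrite !eqxx.
Qed.

End TKAxioms.

(* Main.v *)
(** Up to isomorphism, a model of TK is a countable family, indexed by [U], of
    labellings of the nodes of the full binary tree (the label of a node [c] at
    [u] is the number of successor chains over [(c, u)]), taken modulo the
    automorphisms of the tree.  Level [i] of the tree is [Z/2^i], so every
    natural number is a branch, and the set of these branches is dense.  Colour
    the natural numbers so that every colour class is dense.  By back and forth,
    every permutation of the colours lifts to an automorphism of the tree which
    permutes these branches.  A structure [M] with universe [nat] is coded by
    one labelling for each basic fact symbol [k] and each tuple [ds] of
    branches: the label of a node records [k], which members of [ds] pass
    through the node, and whether [k] holds in [M] at the colours of [ds].  An
    isomorphism of the coding models permutes the branches, and since equality
    is one of the basic facts it induces a permutation of the colours, which is
    an isomorphism of the coded structures. *)

From mathcomp Require Import all_boot all_order ssralg ssrint.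
From mathcomp Require Import boolp classical_sets functions cardinality measure.
From mathcomp Require Import zify.
Require Import Defs.

Set Implicit Arguments.
Unset Strict Implicit.
Unset Printing Implicit Defensive.

Import Order.TTheory.

(** * Lifting permutations of the colours to the binary tree *)

(* The position of the top bit of [p] determines its colour, so that the low
   bits are unconstrained. *)
Definition color (p : nat) : nat := logn 2 (trunc_log 2 p).+1.

Lemma color_dense v i a : exists2 q, q = v %[mod 2 ^ i] & color q = a.
Proof.
(* [K] is at least [i] and [K.+1] has 2-adic valuation [a]: a top bit at position [K] gives colour
   [a] and leaves the [i] low bits free. *)
pose K := (2 ^ a * i.*2.+1).-1.
have KS : K.+1 = 2 ^ a * i.*2.+1 by rewrite prednK // muln_gt0 expn_gt0.
have leiK : i <= K.
  have : i.*2.+1 <= K.+1 by rewrite KS leq_pmull // expn_gt0.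
  lia.
have ltv : v %% 2 ^ i < 2 ^ K.
  by rewrite (leq_trans (ltn_pmod _ _)) ?leq_exp2l ?expn_gt0.
exists (2 ^ K + v %% 2 ^ i).
  by rewrite -(subnK leiK) expnD modnMDl modn_mod.
rewrite /color (@trunc_log_eq 2 K) //; last first.
  by rewrite leq_addr expnS mul2n -addnn ltn_add2l.
rewrite KS lognM ?expn_gt0 // pfactorK // logn_coprime ?addn0 //.
by rewrite coprime2n /= odd_double.
Qed.

Lemma eqm_le p q i j : j <= i -> p == q %[mod 2 ^ i] -> p == q %[mod 2 ^ j].
Proof.
move=> ji /eqP e; rewrite -(modn_dvdm p (dvdn_exp2l 2 ji)) e.
by rewrite modn_dvdm // dvdn_exp2l.
Qed.

Lemma modn2S p i :
  p %% 2 ^ i.+1 = p %% 2 ^ i \/ p %% 2 ^ i.+1 = p %% 2 ^ i + 2 ^ i.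
Proof.
have H : p %% 2 ^ i.+1 %% 2 ^ i = p %% 2 ^ i by rewrite modn_dvdm // dvdn_exp2l.
have lt2 : p %% 2 ^ i.+1 < 2 ^ i + 2 ^ i.
  by rewrite addnn -mul2n -expnS ltn_pmod // expn_gt0.
rewrite -H; case: (ltnP (p %% 2 ^ i.+1) (2 ^ i)) => [lt|ge].
  by left; rewrite (modn_small lt).
right; rewrite -{2}(subnK ge) modnDr (@modn_small (_ - _)) ?subnK //.
lia.
Qed.

(** A node has only two children, so two branches that leave [q] at the same node enter the same
    child. *)
Lemma eqm_split p q r i : p == q %[mod 2 ^ i] -> q == r %[mod 2 ^ i] ->
  p != q %[mod 2 ^ i.+1] -> q != r %[mod 2 ^ i.+1] -> p == r %[mod 2 ^ i.+1].
Proof.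
move=> /eqP e1 /eqP e2.
by case: (modn2S p i) (modn2S q i) (modn2S r i) => -> [] -> [] ->;
  rewrite e1 e2 ?eqxx.
Qed.

Lemma eqm_eq p q : (forall i, p == q %[mod 2 ^ i]) -> p = q.
Proof.
(* Level [p + q] is deep enough, since both numbers are below [2 ^ (p + q)]. *)
move=> /(_ (p + q)) /eqP; rewrite !modn_small //.
all: apply: leq_ltn_trans (ltn_expl _ (isT : 1 < 2)); lia.
Qed.

(** The pairs are (argument, value) entries of a partial map, which is to preserve the 2-adic
    distance. *)
Definition isometric (x y : nat * nat) : Prop :=
  forall i, (x.1 == y.1 %[mod 2 ^ i]) = (x.2 == y.2 %[mod 2 ^ i]).

Lemma isometric_sym x y : isometric x y -> isometric y x.
Proof. by move=> H i; rewrite eq_sym H eq_sym. Qed.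

Definition partial_lift (h : nat -> nat) (s : seq (nat * nat)) : Prop :=
  (forall x, x \in s -> color x.2 = h (color x.1)) /\
  (forall x y, x \in s -> y \in s -> isometric x y).

Lemma separating_level (p : nat) (s : seq nat) :
  p \notin s -> exists i, forall q, q \in s -> p != q %[mod 2 ^ i].
Proof.
elim: s => [|q s IH]; first by exists 0.
rewrite inE negb_or => /andP[npq /IH[i Hi]].
have [j Hj] : exists j, p != q %[mod 2 ^ j].
  apply: contrapT => N; move/eqP: npq; apply; apply: eqm_eq => j.
  by apply: contrapT => /negP ?; apply: N; exists j.
exists (maxn i j) => r; rewrite inE => /predU1P[->|/Hi].
  by apply: contra Hj; apply: eqm_le; rewrite leq_maxr.
by apply: contra; apply: eqm_le; rewrite leq_maxl.
Qed.

(** A new [p] separates from the finite domain at some level [L]. Its image is placed level by level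
    up to [L]; density of the required colour class then gives a value with that residue and the
    right colour. *)
Lemma partial_lift_forth h s p : partial_lift h s ->
  exists q, partial_lift h ((p, q) :: s).
Proof.
move=> [cs es].
case: (boolP (p \in unzip1 s)) => [/mapP[[p' q] xs ->{p}]|nps].
  have sub : {subset (p', q) :: s <= s} by move=> x /predU1P[->|].
  by exists q; split=> [x /sub /cs|x y /sub xs' /sub] //; apply: es.
have [L HL] := separating_level nps.
have approx i : exists v, forall y, y \in s -> forall j, j <= i ->
    (p == y.1 %[mod 2 ^ j]) = (v == y.2 %[mod 2 ^ j]).
  elim: i => [|i [v Hv]].
    by exists 0 => y _ j; rewrite leqn0 => /eqP ->; rewrite !modn1.
  case: (pselect (exists2 x, x \in s & p == x.1 %[mod 2 ^ i.+1]))
    => [[x xs px]|N].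
    exists x.2 => y ys j ji; rewrite -es //.
    by rewrite (eqP (eqm_le ji px)).
  have {}N y : y \in s -> (p == y.1 %[mod 2 ^ i.+1]) = false.
    by move=> ys; apply/negbTE/negP => ?; apply: N; exists y.
  (* At level [i.+1] no argument agrees with [p], so [v] only has to move off all images while
     keeping its residue at level [i]. *)
  suff [w wv Hw] : exists2 w, w == v %[mod 2 ^ i] &
      forall y, y \in s -> w != y.2 %[mod 2 ^ i.+1].
    exists w => y ys j; rewrite leq_eqVlt => /predU1P[->|ji].
      by rewrite N // (negbTE (Hw _ ys)).
    by rewrite Hv // (eqP (eqm_le (ji : j <= i) wv)).
  case: (pselect (exists2 x, x \in s & p == x.1 %[mod 2 ^ i]))
    => [[x xs px]|N'].
    (* The sibling of the node of [x.2]: if some [y.2] passed through it, [eqm_split] would put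
       [y.1] in the same child as [p]. *)
    exists (x.2 + 2 ^ i) => [|y ys].
      by rewrite modnDr eq_sym -Hv.
    apply/negP => e.
    have exy : x.2 == y.2 %[mod 2 ^ i].
      by rewrite -(eqP (eqm_le (leqnSn i) e)) modnDr.
    have nxy : x.2 != y.2 %[mod 2 ^ i.+1].
      rewrite -(eqP e) -{1}(addn0 x.2) eqn_modDl mod0n modn_small ?ltn_exp2l //.
      by rewrite eq_sym -lt0n expn_gt0.
    move: exy nxy; rewrite -!es // => exy nxy.
    by have := eqm_split px exy (negbT (N _ xs)) nxy; rewrite N.
  exists v => // y ys; apply/negP => /(eqm_le (leqnSn i)).
  by rewrite -Hv // => ?; apply: N'; exists y.
have [v Hv] := approx L.
have [q qv cq] := color_dense v L (h (color p)).
have Hq y : y \in s -> isometric (p, q) y.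
  move=> ys i /=; case: (leqP i L) => iL.
    by rewrite Hv // (eqP (eqm_le iL (introT eqP qv))).
  (* Beyond [L] both congruences fail because they already fail at [L]. *)
  have NL : p == y.1 %[mod 2 ^ L] = false.
    by apply/negbTE/HL/map_f.
  apply/idP/idP => /(eqm_le (ltnW iL)); first by rewrite NL.
  by rewrite qv -Hv // NL.
exists q; split=> [x|x y]; rewrite !inE => /predU1P[->|xs] //; first exact: cs.
  by move=> /predU1P[->|ys]; [move=> i; rewrite !eqxx|apply: Hq].
by move=> /predU1P[->|ys]; [apply/isometric_sym/Hq|apply: es].
Qed.

Definition swap (x : nat * nat) := (x.2, x.1).

Lemma swapK : involutive swap. Proof. by case. Qed.

Lemma partial_lift_swap h g s : cancel h g ->
  partial_lift h s -> partial_lift g (map swap s).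
Proof.
move=> hK [cs es]; split=> [x|x y] /mapP[x' xs ->] /=; first by rewrite cs ?hK.
by move=> /mapP[y' ys ->] i /=; rewrite es.
Qed.

(** Swapping coordinates turns this into the forth step for the inverse [g]. *)
Lemma partial_lift_back h g s q :
  cancel h g -> cancel g h -> partial_lift h s ->
  exists p, partial_lift h ((p, q) :: s).
Proof.
move=> hK gK /(partial_lift_swap hK)/(partial_lift_forth q)[p].
move=> /(partial_lift_swap gK); rewrite /= (mapK swapK).
by exists p.
Qed.

Lemma color_lift (h : nat -> nat) : bijective h ->
  exists phi psi : nat -> nat, [/\ cancel phi psi, cancel psi phi,
    forall p, color (phi p) = h (color p)
    & forall p q i, (phi p == phi q %[mod 2 ^ i]) = (p == q %[mod 2 ^ i])].
Proof.
case=> g hK gK.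
have ext (s : {s | partial_lift h s}) n :
    exists t : {s | partial_lift h s}, [/\ {subset sval s <= sval t},
      n \in unzip1 (sval t) & n \in unzip2 (sval t)].
  case: s => s Hs; have [q Hq] := partial_lift_forth n Hs.
  have [p Hp] := partial_lift_back n hK gK Hq.
  exists (exist _ _ Hp); split=> /=; rewrite ?inE ?eqxx ?orbT //.
  by move=> x xs; rewrite !inE xs !orbT.
have nil_ok : partial_lift h [::] by split.
pose step s n := projT1 (cid (ext s n)).
(* Stage [m.+1] puts [m] into both domain and range, so the union of the stages is total in both
   directions. *)
pose s_ := fix s n := if n is m.+1 then step (s m) m else exist _ [::] nil_ok.
have stepP s n := projT2 (cid (ext s n)).
have mono m n : m <= n -> {subset sval (s_ m) <= sval (s_ n)}.
  elim: n => [|n IH]; first by rewrite leqn0 => /eqP ->.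
  rewrite leq_eqVlt => /predU1P[-> //|/IH H] x /H.
  by case: (stepP (s_ n) n) => + _ _; apply.
pose R x := exists n, x \in sval (s_ n).
have Riso x y : R x -> R y -> isometric x y.
  move=> [m xm] [n yn]; case: (svalP (s_ (maxn m n))) => _; apply.
    by apply: mono xm; rewrite leq_maxl.
  by apply: mono yn; rewrite leq_maxr.
have Rcol x : R x -> color x.2 = h (color x.1).
  by case=> n; case: (svalP (s_ n)) => + _; apply.
have /choice[phi Hphi] p : exists q, R (p, q).
  case: (stepP (s_ p) p) => _ /mapP[[p' q] H ->] _.
  by exists q, p.+1.
have /choice[psi Hpsi] q : exists p, R (p, q).
  case: (stepP (s_ q) q) => _ _ /mapP[[p q'] H ->].
  by exists p, q.+1.
exists phi, psi; split=> [p|q|p|p q i].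
(* Two entries sharing one coordinate agree in the other at every level, hence are equal. *)
- by apply: eqm_eq => i; rewrite (Riso _ _ (Hpsi (phi p)) (Hphi p)) /= eqxx.
- by apply: eqm_eq => i; rewrite -(Riso _ _ (Hphi (psi q)) (Hpsi q)) /= eqxx.
- exact: Rcol (Hphi p).
- by rewrite -(Riso _ _ (Hphi p) (Hphi q)).
Qed.

(** * The model of TK attached to a family of facts *)

Lemma countType_nat_bij (X : countType) (f : nat -> X) : injective f ->
  exists ed : (X -> nat) * (nat -> X), cancel ed.1 ed.2 /\ cancel ed.2 ed.1.
Proof.
move=> f_inj.
have : ([set: X] #= [set: nat])%card.
  apply: eq_card_nat => //.
  move=> /(sub_finite_set (@subsetT _ (f @` setT)%classic)).
  rewrite (eq_finite_set (inj_card_eq _)); first exact: infinite_nat.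
  by move=> x y _ _ /f_inj.
move=> /card_set_bijP[e]; rewrite setTT_bijective => -[d edK deK].
by exists (e, d).
Qed.

(** * Semantics of the derived connectives and of the counting sentences *)

Section Sat.
Variables (L : language) (M : structure L).
Implicit Types (e : valuation L) (p q : formula L).

Lemma sat_Forall e x p : sat M e (Forall x p) <->
  forall a, sort_of M a = x.1 -> sat M (update e x a) p.
Proof.
split=> /= [H a sa|H [a [sa]]]; last by apply; apply: H.
by apply: contrapT => N; apply: H; exists a.
Qed.

Lemma sat_Imp e p q : sat M e (Imp p q) <-> (sat M e p -> sat M e q).
Proof.
split=> /= [H Hp|H [Hp]]; last by apply; apply: H.
by apply: contrapT => N; apply: H.
Qed.

Lemma sat_Or e p q : sat M e (Or p q) <-> sat M e p \/ sat M e q.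
Proof.
split=> /= [H|H [Hp Hq]]; last by case: H.
case: (pselect (sat M e p)) => Hp; first by left.
by right; apply: contrapT => Hq; apply: H.
Qed.

Lemma update_eq e x a : update e x a x = a.
Proof. by rewrite /update eqxx. Qed.

Lemma update_neq e x a y : y != x -> update e x a y = e y.
Proof. by rewrite /update => /negbTE ->. Qed.

Lemma sat_FinConj_pairs e (P : nat -> nat -> formula L) (js : seq nat)
    (is_ : nat -> seq nat) :
  sat M e (FinConj [seq P i j | j <- js, i <- is_ j]) <->
  forall j i, j \in js -> i \in is_ j -> sat M e (P i j).
Proof.
have cat ps qs : sat M e (FinConj (ps ++ qs)) <->
    sat M e (FinConj ps) /\ sat M e (FinConj qs).
  elim: ps => /= [|p ps IH]; first by split=> [|[]].
  by rewrite IH; tauto.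
elim: js => //= j js IH; rewrite cat IH; split=> [[Hj Hjs] j' i|H].
  rewrite inE => /predU1P[->|]; last exact: Hjs.
  elim: (is_ j) Hj => //= k ks IHk [Hk /IHk{}IHk].
  by rewrite inE => /predU1P[->|].
split=> [|j' i j's]; last by apply: H; rewrite inE j's orbT.
have {}H i : i \in is_ j -> sat M e (P i j) by apply: H; rewrite mem_head.
elim: (is_ j) H => //= k ks IHk H; split; first by apply: H; rewrite mem_head.
by apply: IHk => i iks; apply: H; rewrite inE iks orbT.
Qed.

End Sat.

Lemma update_vr (e : valuation TK_language) s n a t m :
  update e (vr s n) a (vr t m) = if (t == s) && (m == n) then a else e (vr t m).
Proof. by rewrite /update xpair_eqE. Qed.

Section SatTK.
Variable M : structure TK_language.
Implicit Types (e : valuation TK_language) (s : TK_sort).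

Lemma sat_Exists_block e s D ks :
  sat M e (foldr (fun k p => Exists (vr s k) p) D ks) <->
  exists e', [/\ forall k, k \in ks -> sort_of M (e' (vr s k)) = s,
    forall y, y \notin map (vr s) ks -> e' y = e y & sat M e' D].
Proof.
elim: ks e => [|k ks IH] e /=.
  split=> [HD|[e' [_ He HD]]]; first by exists e.
  by rewrite (_ : e = e') //; apply: funext => y; rewrite He.
split=> [[a [sa /IH[e' [He's He' HD]]]]|[e' [He's He' HD]]].
  exists e'; split=> // [k'|y]; last first.
    by rewrite inE negb_or => /andP[yk yks]; rewrite He' // update_neq.
  (* If [k] recurs in [ks], an inner quantifier rebinds it; otherwise [e'] keeps the value [a]. *)
  case: (boolP (k' \in ks)) => [/He's //|k'ks].
  rewrite inE (negbTE k'ks) orbF => /eqP kk'; move: k'ks; rewrite kk' => kks.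
  rewrite He' ?update_eq //; apply/negP => /mapP[k2 k2s [E]].
  by rewrite E k2s in kks.
exists (e' (vr s k)); split; first by apply: He's; rewrite mem_head.
apply/IH; exists e'; split=> // [k' k'ks|y yks].
  by apply: He's; rewrite inE k'ks orbT.
case: (eqVneq y (vr s k)) => [->|yk]; first by rewrite update_eq.
by rewrite update_neq // He' // inE negb_or yk.
Qed.

Lemma sat_at_least e s n : sat M e (at_least s n) <->
  exists g : nat -> nat, (forall i, i < n -> sort_of M (g i) = s) /\
    forall i j, i < j -> j < n -> g i <> g j.
Proof.
rewrite /at_least sat_Exists_block; split=> [[e' [He's _]]|[g [gs g_inj]]].
  rewrite sat_FinConj_pairs => HD; exists (fun i => e' (vr s i)).
  split=> [i ltin|i j ij jn].
    by apply: He's; rewrite mem_iota.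
  by apply: (HD j i); rewrite mem_iota.
exists (fun y => if y \in map (vr s) (iota 0 n) then g y.2 else e y); split.
- by move=> k kn; rewrite map_f // gs //; move: kn; rewrite mem_iota.
- by move=> y /negbTE ->.
apply/sat_FinConj_pairs => j i jn ij /=.
move: jn ij; rewrite !mem_iota /= !add0n => jn ij.
by rewrite !map_f ?mem_iota //=; [apply: g_inj|apply: ltn_trans jn].
Qed.

End SatTK.

Lemma pigeonhole m n (f : nat -> nat) : (forall i, i < m -> f i < n) ->
  (forall i j, i < j -> j < m -> f i <> f j) -> m <= n.
Proof.
move=> fn f_inj; rewrite -(size_iota 0 m) -(size_map f) -(size_iota 0 n).
apply: uniq_leq_size => [|x /mapP[i]]; last by rewrite !mem_iota => /fn ? ->.
rewrite map_inj_in_uniq ?iota_uniq // => i j; rewrite !mem_iota /= !add0n.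
move=> im jm fij; case: (ltngtP i j) => // [ij|ji].
  by case: (f_inj _ _ ij jm).
by case: (f_inj _ _ ji im).
Qed.

(** * Elements, functions and axioms of the coding model *)

Section Encoding.
Variable K : countType.

Definition point : countType := {i : nat & 'I_(2 ^ i)}.
Definition param : countType := option (K * seq nat).
(** The natural number names a successor chain and the integer is the position on it. *)
Definition strand : countType := (param * point * nat * int)%type.
Definition elt : countType := (param + point + strand)%type.

Definition res (c : point) : nat := tagged c.

Lemma ltn_mod2 v i : v %% 2 ^ i < 2 ^ i.
Proof. by rewrite ltn_pmod // expn_gt0. Qed.

Definition node i v : point :=
  existT (fun i => 'I_(2 ^ i)) i (Ordinal (ltn_mod2 v i)).

Lemma nodeK (c : point) : node (tag c) (res c) = c.
Proof.
case: c => i v; congr existT; apply: val_inj => /=.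
by rewrite modn_small // ltn_ord.
Qed.

Lemma node_eq i v w : node i v = node i w <-> v = w %[mod 2 ^ i].
Proof.
split=> [/(congr1 res) //|e].
by congr existT; apply: val_inj.
Qed.

Definition over (c : point) (d : nat) : bool := d == res c %[mod 2 ^ tag c].

(** Pickling makes the triple recoverable from the number of chains. The successor keeps labels
    positive, so that no fiber of the projections is empty. *)
Definition label (T : K -> seq nat -> bool) k ds (c : point) : nat :=
  (pickle (k, T k (map color ds), map (over c) ds)).+1.

(* The chains [(u, c, j)] exist for all [j], independently of [T]; those with
   [j] beyond the label of [u] at [c] are moved over the parameter [None], which
   has infinitely many chains over every node anyway.  Thus only [pi1] depends
   on [T]. *)
Definition owner T (u : param) c j : param :=
  if u is Some (k, ds) then if j < label T k ds c then u else None else None.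

Definition elt_sort (x : elt) : TK_sort :=
  match x with
  | inl (inl _) => U
  | inl (inr c) => C (tag c)
  | inr (_, c, _, _) => V (tag c)
  end.

Definition of_param (u : param) : elt := inl (inl u).
Definition of_point (c : point) : elt := inl (inr c).
Definition of_strand (u : param) (c : point) (j : nat) (z : int) : elt :=
  inr (u, c, j, z).

(** [tau] drops the top bit of a residue. Sorts and levels are tested in [TK_funI]. *)
Definition act T (f : TK_fun) (x : elt) : elt :=
  match f, x with
  | Succ _, inr (u, c, j, z) => of_strand u c j (z + 1)%R
  | pi0 _, inr (_, c, _, _) => of_point c
  | pi1 _, inr (u, c, j, _) => of_param (owner T u c j)
  | tau i, inl (inr c) => of_point (node i (res c))
  | _, _ => x
  end.

Lemma act_sort T (f : Fun TK_language) x : [:: elt_sort x] = fdom f ->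
  elt_sort (act T f x) = fcod f.
Proof.
by case: f => i; case: x => [[u|c]|[[[u c] j] z]] // [e] //=; rewrite e.
Qed.

Lemma elt_enumerable :
  exists ed : (elt -> nat) * (nat -> elt), cancel ed.1 ed.2 /\ cancel ed.2 ed.1.
Proof.
by apply: (@countType_nat_bij _ (fun n => of_point (node n 0))) => m n [].
Qed.

Definition enc : elt -> nat := (sval (cid elt_enumerable)).1.
Definition dec : nat -> elt := (sval (cid elt_enumerable)).2.
Lemma encK : cancel enc dec. Proof. exact: (svalP (cid elt_enumerable)).1. Qed.
Lemma decK : cancel dec enc. Proof. exact: (svalP (cid elt_enumerable)).2. Qed.

Section Model.
Variables (k0 : K) (T : K -> seq nat -> bool).

Definition TK_sort_of (n : nat) : Sort TK_language := elt_sort (dec n).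
Definition TK_funI (f : Fun TK_language) (a : seq nat) : nat :=
  if map TK_sort_of a == fdom f then enc (act T f (dec (head 0 a))) else 0.
Definition TK_relI (r : Rel TK_language) (a : seq nat) : bool :=
  match r with end.

Lemma TK_funI_sort f a : map TK_sort_of a = fdom f ->
  TK_sort_of (TK_funI f a) = fcod f.
Proof.
move=> sa; rewrite /TK_funI sa eqxx /TK_sort_of encK; apply: act_sort.
by rewrite -sa; case: a sa => [|a [|b l]]; case: f.
Qed.

Lemma TK_funI_junk f a : map TK_sort_of a <> fdom f -> TK_funI f a = 0.
Proof. by rewrite /TK_funI => /eqP/negbTE ->. Qed.

Lemma TK_relI_sort r a : TK_relI r a -> map TK_sort_of a = rdom r.
Proof. by case: r. Qed.

Definition TK_of : structure TK_language :=
  Structure TK_funI_sort TK_funI_junk TK_relI_sort.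

Lemma sort_enc x : TK_sort_of (enc x) = elt_sort x.
Proof. by rewrite /TK_sort_of encK. Qed.

Lemma funI_enc (f : Fun TK_language) x : [:: elt_sort x] = fdom f ->
  TK_funI f [:: enc x] = enc (act T f x).
Proof. by rewrite /TK_funI /= /TK_sort_of encK => ->; rewrite eqxx. Qed.

Lemma TK_of_U a : TK_sort_of a = U -> exists u, a = enc (of_param u).
Proof.
by rewrite -{1}(decK a) sort_enc; case E: (dec a) => [[u|c]|[[[u c] j] z]] //=;
  exists u; rewrite -(decK a) E.
Qed.

Lemma TK_of_C i a : TK_sort_of a = C i ->
  exists v, a = enc (of_point (node i v)).
Proof.
rewrite -{1}(decK a) sort_enc.
case E: (dec a) => [[u|c]|[[[u c] j] z]] //= [<-].
by exists (res c); rewrite nodeK -(decK a) E.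
Qed.

Lemma TK_of_V i a : TK_sort_of a = V i ->
  exists u v j z, a = enc (of_strand u (node i v) j z).
Proof.
rewrite -{1}(decK a) sort_enc.
case E: (dec a) => [[u|c]|[[[u c] j] z]] //= [<-].
by exists u, (res c), j, z; rewrite nodeK -(decK a) E.
Qed.

Lemma iter_Succ n u c j z :
  iter n (fun a => TK_funI (Succ (tag c)) [:: a]) (enc (of_strand u c j z)) =
  enc (of_strand u c j (z + n%:Z)%R).
Proof.
elim: n => [|n IH]; first by rewrite /= GRing.addr0.
rewrite iterS IH funI_enc //=; congr (enc (of_strand _ _ _ _)); lia.
Qed.

Lemma eval_iter_Succ e i n t :
  eval TK_of e (iter n (ap (Succ i)) t) =
  iter n (fun a => TK_funI (Succ i) [:: a]) (eval TK_of e t).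
Proof. by elim: n => //= n ->. Qed.

(** Labels are positive, so chain 0 always stays with its own parameter. *)
Lemma owner_Some u c : owner T u c 0 = u.
Proof. by case: u => [[k ds]|]. Qed.


Lemma C_eqE i j : (C i == C j) = (i == j).
Proof. by apply/eqP/eqP => [[]|->]. Qed.

Lemma sat_C_lower e i : sat TK_of e (at_least (C i) (2 ^ i)).
Proof.
apply/sat_at_least; exists (fun v => enc (of_point (node i v))).
split=> [v _|v w vw lt /(can_inj encK)[/eqP]]; first exact: sort_enc.
by rewrite !modn_small ?(ltn_trans vw lt) // ltn_eqF.
Qed.

Lemma sat_C_upper e i : ~ sat TK_of e (at_least (C i) (2 ^ i).+1).
Proof.
move=> /sat_at_least[g [gs g_inj]].
pose r j := if dec (g j) is inl (inr c) then res c else 0.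
suff : (2 ^ i).+1 <= 2 ^ i by rewrite ltnn.
apply: (@pigeonhole _ _ r) => [j /gs|j k jk kn].
  by move=> /TK_of_C[v gj]; rewrite /r gj encK; apply: ltn_mod2.
have [v gj] := TK_of_C (gs j (ltn_trans jk kn)).
have [w gk] := TK_of_C (gs k kn).
rewrite /r gj gk !encK => /= e'; apply: (g_inj j k jk kn).
by rewrite gj gk; congr (enc (of_point _)); apply/node_eq.
Qed.

Lemma TK_of_models (p : formula TK_language) : TK p -> models TK_of p.
Proof.
have enc_inj := can_inj encK.
case=> [n|i n|i|i|i|i|i|i|i n|i] => [e|e|e|e|y z e|e|e|e|e|e].
(* Tuples of zeros of different lengths give distinct parameters. *)
- apply/sat_at_least; exists (fun j => enc (of_param (Some (k0, nseq j 0)))).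
  split=> [j _|j k jk _ /enc_inj[/(congr1 size)]]; first exact: sort_enc.
  by rewrite !size_nseq => jk'; rewrite jk' ltnn in jk.
- apply/sat_at_least; exists (fun j => enc (of_strand None (node i 0) j 0)).
  split=> [j _|j k jk _ /enc_inj[jk']]; first exact: sort_enc.
  by rewrite jk' ltnn in jk.
- split; [exact: sat_C_lower|exact: sat_C_upper].
- apply/sat_Forall => _ /TK_of_C[v ->] /=.
  exists (enc (of_point (node i.+1 v))); split; first exact: sort_enc.
  rewrite !update_vr !eqxx /= C_eqE (ltn_eqF (ltnSn i)) /= funI_enc //=.
  congr (enc (of_point _)); apply/node_eq.
  by rewrite /= modn_dvdm // dvdn_exp2l.
- apply/sat_Forall => _ /TK_of_C[v ->].
  (* The two children of the node of [v]: the next bit is 0 or 1. *)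
  exists (enc (of_point (node i.+1 (v %% 2 ^ i)))).
  split; first exact: sort_enc.
  exists (enc (of_point (node i.+1 (v %% 2 ^ i + 2 ^ i)))).
  split; first exact: sort_enc.
  have [lt0 lt1] : v %% 2 ^ i < 2 ^ i.+1 /\ v %% 2 ^ i + 2 ^ i < 2 ^ i.+1.
    by have := ltn_mod2 v i; rewrite expnS; lia.
  split.
    rewrite /= !update_vr !eqxx /= => /enc_inj[].
    rewrite (modn_small lt0) (modn_small lt1) => /eqP.
    by rewrite -{1}(addn0 (v %% _)) eqn_add2l ltn_eqF ?expn_gt0.
  apply/sat_Forall => _ /TK_of_C[w ->]; split.
    apply/sat_Imp => H; apply/sat_Or; move: H => /=.
    rewrite !update_vr !C_eqE !eqxx (ltn_eqF (ltnSn i)) /= funI_enc //=.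
    move=> /enc_inj[].
    rewrite modn_dvdm ?dvdn_exp2l // => e'.
    rewrite -e'; case: (modn2S w i) => w2; [left|right];
      congr (enc (of_point _)).
      by apply/node_eq; rewrite -w2 modn_mod.
    by apply/node_eq; rewrite -w2 modn_mod.
  apply/sat_Imp => /sat_Or /=; rewrite !update_vr !C_eqE !eqxx /= => H.
  rewrite (ltn_eqF (ltnSn i)) /=.
  case: H => ->; rewrite funI_enc //=; congr (enc (of_point _));
    apply/node_eq => /=.
    by rewrite modn_dvdm ?dvdn_exp2l // modn_mod.
  by rewrite modn_dvdm ?dvdn_exp2l // modnDr modn_mod.
- apply/sat_Forall => _ /TK_of_C[v ->]; apply/sat_Forall => _ /TK_of_U[u ->] /=.
  exists (enc (of_strand u (node i v) 0 0)); split; first exact: sort_enc.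
  by rewrite !update_vr !eqxx /= !funI_enc //= owner_Some.
- apply/sat_Forall => _ /TK_of_V[u [v [j [z ->]]]].
  apply/sat_Forall => _ /TK_of_V[u' [v' [j' [z' ->]]]]; apply/sat_Imp => /=.
  rewrite !update_vr !eqxx /= !funI_enc //= => /enc_inj [-> vv' -> zz'].
  rewrite (_ : z = z'); last by lia.
  by congr (enc (of_strand _ _ _ _)); apply/node_eq.
- apply/sat_Forall => _ /TK_of_V[u [v [j [z ->]]]] /=.
  exists (enc (of_strand u (node i v) j (z - 1)%R)).
  split; first exact: sort_enc.
  rewrite !update_vr !eqxx /= funI_enc //=.
  congr (enc (of_strand _ _ _ _)); lia.
- apply/sat_Forall => _ /TK_of_V[u [v [j [z ->]]]] /= .
  have := iter_Succ n.+1 u (node i v) j z; rewrite iterS /= => iterE.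
  rewrite eval_iter_Succ /= update_vr !eqxx /= iterE => /enc_inj[]; lia.
- apply/sat_Forall => _ /TK_of_V[u [v [j [z ->]]]] /=.
  by rewrite !update_vr !eqxx /= !funI_enc.
Qed.

End Model.
End Encoding.

(** * Isomorphisms of the attached models *)

(** The body of [iso] with its witness exposed. *)
Definition is_iso (L : language) (M N : structure L) (h : nat -> nat) : Prop :=
  [/\ bijective h,
      forall a, sort_of N (h a) = sort_of M a,
      forall f a, map (sort_of M) a = fdom f ->
        funI N f (map h a) = h (funI M f a)
    & forall r a, map (sort_of M) a = rdom r ->
        relI N r (map h a) = relI M r a].

Lemma is_iso_inv (L : language) (M N : structure L) h :
  is_iso M N h -> exists2 g, is_iso N M g & cancel h g /\ cancel g h.
Proof.
case=> -[g hK gK] hs hf hr; exists g => //.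
have gs a : sort_of M (g a) = sort_of N a by rewrite -hs gK.
have gsm a : map (sort_of M) (map g a) = map (sort_of N) a.
  by rewrite -map_comp; apply: eq_map => x /=.
have hgm a : map h (map g a) = a by rewrite mapK.
split=> //; first by exists h.
- by move=> f a fa; apply: (can_inj hK); rewrite gK -hf ?gsm // hgm.
- by move=> r a ra; rewrite -hr ?gsm // hgm.
Qed.

(** At least [m] chains over [(c, u)]: since [j] and [k] range over ordered pairs, no representative
    is reached from another in either direction. *)
Definition has_chains (M : structure TK_language) i c u m : Prop :=
  exists g : nat -> nat,
    (forall j, j < m -> [/\ sort_of M (g j) = V i,
      funI M (pi0 i) [:: g j] = c & funI M (pi1 i) [:: g j] = u]) /\
    (forall j k n, j < m -> k < m -> j <> k ->
      iter n (fun a => funI M (Succ i) [:: a]) (g j) <> g k).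

Lemma has_chains_iso (M N : structure TK_language) h i c u m :
  is_iso M N h -> has_chains M i c u m -> has_chains N i (h c) (h u) m.
Proof.
case=> hbij hs hf _ [g [gV gS]]; exists (h \o g); split=> [j /gV[gj <- <-]|].
  rewrite /= hs gj; split=> //.
    by rewrite -(hf (pi0 i) [:: g j]) //= gj.
  by rewrite -(hf (pi1 i) [:: g j]) //= gj.
move=> j k n jm km jk; have [sj _ _] := gV j jm.
(* The sort is carried through the induction because [h] commutes with [Succ i] only on sort
   [V i]. *)
suff [_ ->] :
    sort_of M (iter n (fun a => funI M (Succ i) [:: a]) (g j)) = V i /\
    iter n (fun a => funI N (Succ i) [:: a]) (h (g j)) =
    h (iter n (fun a => funI M (Succ i) [:: a]) (g j)).
  by move=> /(bij_inj hbij); apply: gS.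
elim: n => [//|n [IHs IH]]; split.
  by rewrite iterS (@funI_sort _ M (Succ i)) //= IHs.
by rewrite !iterS IH -(hf (Succ i) [:: _]) //= IHs.
Qed.

Section Iso.
Variable K : countType.
Implicit Types (T : K -> seq nat -> bool) (u : param K) (c : point).

(** [None] owns infinitely many chains over every node, hence has no bound. *)
Definition chain_bound T u c m : bool :=
  if u is Some (k, ds) then m <= label T k ds c else true.

Lemma owner_bound T u c j : chain_bound T u c j.+1 = (owner T u c j == u).
Proof.
case: u => [[k ds]|] //=.
by case: ifP => _; rewrite ?eqxx.
Qed.

Lemma of_point_inj : injective (@of_point K).
Proof.
by move=> c d /(congr1 (fun x => if x is inl (inr e) then e else c)).
Qed.

Lemma has_chainsP T u c m :
  has_chains (TK_of T) (tag c) (enc (of_point K c)) (enc (of_param u)) m <->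
  chain_bound T u c m.
Proof.
have enc_inj := can_inj (@encK K).
split=> [[g [gV gS]]|mb]; last first.
  exists (fun j => enc (of_strand u c j 0)); split=> [j jm|j k n jm km jk].
    split; [exact: sort_enc|by rewrite [LHS]funI_enc|].
    rewrite [LHS]funI_enc //=; congr (enc (of_param _)); apply/eqP.
    rewrite -owner_bound; case: u mb => [[k ds]|] //=; exact: leq_trans.
  by rewrite iter_Succ => /enc_inj[].
case: u gV => [[k ds]|] //= gV.
have {gV}gV j : j < m -> exists j' z,
    j' < label T k ds c /\ g j = enc (of_strand (Some (k, ds)) c j' z).
  move=> /gV[/TK_of_V[u [v [j' [z ->]]]]]; rewrite !funI_enc //=.
  move=> /enc_inj/of_point_inj -> /enc_inj[].
  case: u => [[k' ds']|] //=; case: ifP => // lt [<- <-].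
  by exists j', z.
(* The chain index is injective on representatives: two strands on one chain differ by an integer
   shift, so one is an iterate of the other. *)
pose f j := if dec K (g j) is inr (_, _, j', _) then j' else 0.
apply: (@pigeonhole _ _ f) => [j /gV[j' [z [lt gj]]]|j j2 jj2 j2m].
  by rewrite /f gj encK.
have [j' [z [_ gj]]] := gV j (ltn_trans jj2 j2m).
have [j2' [z2 [_ gj2]]] := gV j2 j2m.
rewrite /f gj gj2 !encK /= => e; subst j2'.
case: (leP z z2) => [le|/ltW le].
  apply: (gS j j2 `|(z2 - z)%R|%N) => //; first exact: ltn_trans j2m.
    lia.
  rewrite gj gj2 [LHS]iter_Succ; congr (enc (of_strand _ _ _ _)); lia.
apply: (gS j2 j `|(z - z2)%R|%N) => //; first exact: ltn_trans j2m.
  lia.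
rewrite gj gj2 [LHS]iter_Succ; congr (enc (of_strand _ _ _ _)); lia.
Qed.

Lemma overE c d : over c d = (node (tag c) d == c).
Proof.
rewrite -[c in RHS]nodeK /over.
by apply/eqP/eqP => /node_eq.
Qed.

(** * From an isomorphism of coding models to a bijection of the colours *)

Section Backward.
Variables (T T' : K -> seq nat -> bool) (h : nat -> nat).
Hypothesis hiso : is_iso (TK_of T) (TK_of T') h.

(** Sorts force [h] to act on nodes level by level and on parameters; transporting chains along [h]
    and its inverse equates the counts. *)
Lemma iso_maps : exists (s : point -> point) (t : param K -> param K),
  (forall c, tag (s c) = tag c) /\
  forall u, [/\ h (enc (of_param u)) = enc (of_param (t u)) &
    forall c m, chain_bound T' (t u) (s c) m = chain_bound T u c m].
Proof.
case: (hiso) => _ hs _ _.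
have /choice[s Hs] c : exists d, tag d = tag c /\
    h (enc (of_point K c)) = enc (of_point K d).
  have [v hv] : exists v,
      h (enc (of_point K c)) = enc (of_point K (node (tag c) v)).
    by apply: (@TK_of_C K); rewrite [LHS]hs; apply: sort_enc.
  by exists (node (tag c) v).
have /choice[t Ht] (u : param K) : exists v : param K,
    h (enc (of_param u)) = enc (of_param v).
  by apply: (@TK_of_U K); rewrite [LHS]hs; apply: sort_enc.
exists s, t; split=> [c|u]; first by case: (Hs c).
split=> // c m; case: (Hs c) => tc hc.
have [g giso [hK gK]] := is_iso_inv hiso.
apply/idP/idP => /has_chainsP H; apply/has_chainsP.
  by have := has_chains_iso giso H; rewrite -hc -Ht !hK tc.
by have := has_chains_iso hiso H; rewrite hc Ht -tc.
Qed.

Lemma iso_color_map (k0 : K) : exists phi : nat -> nat,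
  (forall k ds, T k (map color ds) = T' k (map color (map phi ds))) /\
  forall q, exists p, phi p = q.
Proof.
have [s [t [stag Ht]]] := iso_maps.
(* [None] is the only parameter with infinitely many chains over a node. *)
have tNone : t None = None.
  have [_ H] := Ht None; case E: (t None) => [[k ds]|] //.
  have := H (node 0 0) (label T' k ds (s (node 0 0))).+1.
  by rewrite E /= ltnn.
(* Equal counts mean equal labels, and unpickling recovers the symbol, the truth value and the
   incidences. *)
have tSome k ds : exists ds', [/\ t (Some (k, ds)) = Some (k, ds'),
    T k (map color ds) = T' k (map color ds')
    & forall c, map (over c) ds = map (over (s c)) ds'].
  have [_ H] := Ht (Some (k, ds)); case E: (t _) H => [[k' ds']|] H; last first.
    by have := H (node 0 0) (label T k ds (node 0 0)).+1; rewrite /= ltnn.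
  have lab c : label T' k' ds' (s c) = label T k ds c.
    apply/eqP; rewrite eqn_leq.
    have /= <- := H c (label T' k' ds' (s c)).
    have /= -> := H c (label T k ds c).
    by rewrite !leqnn.
  exists ds'; have {}lab c : (k', T' k' (map color ds'), map (over (s c)) ds') =
      (k, T k (map color ds), map (over c) ds).
    by apply: (pcan_inj choice.pickleK); case: (lab c).
  by have [<- -> _] := lab (node 0 0); split=> // c; case: (lab c).
(* The parameter of [[:: d]] goes to that of a one-element tuple, whose entry is the image
   branch. *)
have /choice[phi Hphi] d : exists d', forall c, over c d = over (s c) d'.
  have [[|d' [|? ?]] [_ _ H]] := tSome k0 [:: d]; try by have := H (node 0 0).
  by exists d' => c; case: (H c).
(* A branch is determined by its nodes, so the image of [d] is the same for every symbol and tuple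
   in which [d] occurs. *)
have phi_uniq d d' : (forall c, over c d = over (s c) d') -> d' = phi d.
  move=> H; apply: eqm_eq => i.
  have : over (s (node i d)) d' && over (s (node i d)) (phi d).
    by rewrite -H -Hphi /over /= modn_mod eqxx.
  rewrite !overE; rewrite stag /=.
  by case/andP => /eqP<- /eqP /node_eq ->.
have mapE ds ds' : (forall c, map (over c) ds = map (over (s c)) ds') ->
    ds' = map phi ds.
  elim: ds ds' => [|d ds IH] [|d' ds'] H //; try by have := H (node 0 0).
  rewrite /= (phi_uniq d d') => [|c]; last by case: (H c).
  by rewrite (IH ds') // => c; case: (H c).
exists phi; split=> [k ds|q].
  by have [ds' [_ -> /mapE ->]] := tSome k ds.
(* Surjectivity: the parameter of [[:: q]] is pulled back along the inverse isomorphism. *)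
have [g giso [hK gK]] := is_iso_inv hiso.
have [u tu] : exists u, t u = Some (k0, [:: q]).
  have [u gu] : exists u,
      g (enc (of_param (Some (k0, [:: q])))) = enc (of_param u).
    case: giso => _ gs _ _.
    by apply: (@TK_of_U K); rewrite [LHS]gs; apply: sort_enc.
  exists u; have [hu _] := Ht u; move: hu; rewrite -gu gK.
  by move=> /(can_inj (@encK K)) [].
case: u tu => [[k ds]|]; last by rewrite tNone.
have [ds' [-> _ /mapE ->]] := tSome k ds.
by case: ds => [|p [|? ?]] // [_ <-]; exists p.
Qed.

End Backward.

(** Since [eqk] codes equality, [phi] preserves and reflects equality of colours and induces an
    injection on them, onto because [phi] is. Every tuple of colours comes from a tuple of branches,
    so all facts transfer. *)
Lemma iso_TK_of_inv T T' (eqk : K) :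
  (forall a b, T eqk [:: a; b] = (a == b)) ->
  (forall a b, T' eqk [:: a; b] = (a == b)) ->
  iso (TK_of T) (TK_of T') ->
  exists2 f, bijective f & forall k a, T k a = T' k (map f a).
Proof.
move=> Teq T'eq [h hiso].
have [phi [phiT phi_surj]] := iso_color_map hiso eqk.
have phi_eq p q : (color (phi p) == color (phi q)) = (color p == color q).
  by have := phiT eqk [:: p; q]; rewrite /= Teq T'eq.
have /choice[r Hr] a : exists p, color p = a.
  by have [p _ <-] := color_dense 0 0 a; exists p.
pose f a := color (phi (r a)).
have fE p : color (phi p) = f (color p) by apply/eqP; rewrite phi_eq Hr.
have /choice[f' Hf'] b : exists a, f a = b.
  by have [p pb] := phi_surj (r b); exists (color p); rewrite -fE pb Hr.
exists f => [|k a].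
  exists f' => // a; have := Hf' (f a); rewrite /f => /eqP.
  by rewrite phi_eq !Hr => /eqP.
have -> : a = map color (map r a).
  by rewrite -map_comp -[LHS]map_id; apply: eq_map => x /=.
rewrite phiT -!map_comp; congr (T' k _); apply: eq_map => x /=.
by rewrite fE.
Qed.

(** * From a bijection of the colours to an isomorphism of coding models *)

Section Forward.
Variable phi : nat -> nat.
Hypothesis phi_isometric :
  forall p q i, (phi p == phi q %[mod 2 ^ i]) = (p == q %[mod 2 ^ i]).

(** The residue [res c] is itself a branch through [c]; as [phi] is isometric, any other such branch
    gives the same node. *)
Definition map_point c : point := node (tag c) (phi (res c)).
Definition map_param u : param K :=
  if u is Some (k, ds) then Some (k, map phi ds) else None.
Definition map_elt (x : elt K) : elt K :=
  match x with
  | inl (inl u) => of_param (map_param u)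
  | inl (inr c) => of_point K (map_point c)
  | inr (u, c, j, z) => of_strand (map_param u) (map_point c) j z
  end.

Lemma elt_sort_map x : elt_sort (map_elt x) = elt_sort x.
Proof. by case: x => [[u|c]|[[[u c] j] z]]. Qed.

Lemma map_point_node i v : map_point (node i v) = node i (phi v).
Proof. by apply/node_eq/eqP; rewrite phi_isometric /= modn_mod. Qed.

Lemma over_map c d : over (map_point c) (phi d) = over c d.
Proof. by rewrite /over /= modn_mod phi_isometric. Qed.

(** The family of facts enters [act] only through labels, and these agree because [phi] preserves
    incidences and truth values. *)
Lemma act_map T T' (f : Fun TK_language) x : [:: elt_sort x] = fdom f ->
  (forall k ds, T k (map color ds) = T' k (map color (map phi ds))) ->
  act T' f (map_elt x) = map_elt (act T f x).
Proof.
move=> fx TT'.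
have labE k ds c : label T' k (map phi ds) (map_point c) = label T k ds c.
  rewrite /label -TT' -map_comp; congr (pickle (_, _, _)).+1.
  by apply: eq_map => d; apply: over_map.
case: f x fx => i [[u|c]|[[[u c] j] z]] //= [ci].
  congr (of_param _); case: u => [[k ds]|] //=.
  by rewrite labE; case: ifP.
congr (of_point _ _); rewrite map_point_node; apply/node_eq.
by rewrite /= modn_dvdm // ci dvdn_exp2l.
Qed.

End Forward.

Lemma map_eltK phi psi :
  (forall p q i, (phi p == phi q %[mod 2 ^ i]) = (p == q %[mod 2 ^ i])) ->
  (forall p q i, (psi p == psi q %[mod 2 ^ i]) = (p == q %[mod 2 ^ i])) ->
  cancel phi psi -> cancel (map_elt phi) (map_elt psi).
Proof.
move=> iphi ipsi phiK.
have pK c : map_point psi (map_point phi c) = c.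
  by rewrite {2}/map_point map_point_node // phiK nodeK.
have uK u : map_param psi (map_param phi u) = u.
  by case: u => [[k ds]|] //=; rewrite mapK.
by case=> [[u|c]|[[[u c] j] z]] /=; rewrite ?pK ?uK.
Qed.

Lemma iso_TK_of T T' f : bijective f ->
  (forall k a, T k a = T' k (map f a)) -> iso (TK_of T) (TK_of T').
Proof.
move=> /color_lift[phi [psi [phiK psiK phi_color iphi]]] TT'.
have ipsi p q i : (psi p == psi q %[mod 2 ^ i]) = (p == q %[mod 2 ^ i]).
  by rewrite -iphi !psiK.
exists (fun a => enc (map_elt phi (dec K a))).
split=> [|a|g a ga|[]].
- exists (fun a => enc (map_elt psi (dec K a))) => a; rewrite encK.
    by rewrite (map_eltK iphi ipsi) // decK.
  by rewrite (map_eltK ipsi iphi) // decK.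
- by rewrite /= /TK_sort_of encK elt_sort_map.
have [x [-> sx]] : exists x : elt K, a = [:: enc x] /\ [:: elt_sort x] = fdom g.
  case: a ga => [|b [|? ?]] ga; try by case: (g) ga.
  by exists (dec K b); rewrite decK -ga.
rewrite /= encK funI_enc ?elt_sort_map // funI_enc // encK.
congr enc; apply: act_map => // k ds.
rewrite TT' -!map_comp; congr (T' k _).
by apply: eq_map => d /=.
Qed.

End Iso.

(** * Coding arbitrary structures *)

Section Facts.
Variable L : language.
Implicit Types M N : structure L.

(** [None] is the symbol for equality. A function symbol stands for its graph, with the value put
    first in the tuple. *)
Definition fact : countType := option (Sort L + (Fun L + Rel L))%type.

Definition holds M (k : fact) (a : seq nat) : bool :=
  match k, a with
  | None, [:: a; b] => a == b
  | Some (inl s), [:: a] => sort_of M a == s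
  | Some (inr (inl f)), b :: a =>
      (map (sort_of M) a == fdom f) && (funI M f a == b)
  | Some (inr (inr r)), a => relI M r a
  | _, _ => false
  end.

(** Sorts, graphs and relations are all read off from facts; on ill-sorted tuples graph and relation
    facts are false on both sides. *)
Lemma iso_holds M N : iso M N <->
  exists2 f, bijective f & forall k a, holds M k a = holds N k (map f a).
Proof.
split=> [[f [fbij fs ff fr]]|[f fbij fh]]; exists f => //.
  have fsm a : map (sort_of N) (map f a) = map (sort_of M) a.
    by rewrite -map_comp; apply: eq_map => x /=.
  case=> [[s|[g|r]]|] a /=.
  - by case: a => [|a [|? ?]] //=; rewrite fs.
  - case: a => [|b a] //=; rewrite fsm; case: eqP => //= ga.
    by rewrite ff // (inj_eq (bij_inj fbij)).
  - case: (eqVneq (map (sort_of M) a) (rdom r)) => [/fr -> //|/eqP ra].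
    by apply/idP/idP => /relI_sort // ; rewrite fsm.
  - by case: a => [|a [|b [|? ?]]] //=; rewrite (inj_eq (bij_inj fbij)).
have fs a : sort_of N (f a) = sort_of M a.
  by have /= := fh (Some (inl (sort_of M a))) [:: a]; rewrite eqxx => /esym/eqP.
split=> // [g a ga|r a _].
  have := fh (Some (inr (inl g))) (funI M g a :: a); rewrite /= ga !eqxx /=.
  by move=> /esym/andP[_ /eqP].
by apply: esym (fh (Some (inr (inr r))) a).
Qed.

End Facts.

(** * Borel sets defined by facts *)

Section Borel.
Variables (L : language) (T : set (formula L)).
Local Open Scope classical_set_scope.

Lemma borelC (A : set (Mod T)) : borel A -> borel (~` A).
Proof.
by rewrite -setTD; case: (smallest_sigma_algebra [set: Mod T]
  [set [set M | A (sval M)] | A in @subbasic L]) => _ + _; apply.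
Qed.

Lemma borel_cst (P : Prop) : borel [set _ : Mod T | P].
Proof.
have b0 : borel (@set0 (Mod T)).
  by case: (smallest_sigma_algebra [set: Mod T]
    [set [set M | A (sval M)] | A in @subbasic L]).
case: (pselect P) => p.
  rewrite (_ : [set _ | P] = ~` set0); first exact: borelC.
  by rewrite setC0; apply/seteqP; split.
by rewrite (_ : [set _ | P] = set0) //; apply/seteqP; split.
Qed.

Lemma borel_subbasic (A : set (structure L)) : subbasic A ->
  borel [set M : Mod T | A (sval M)].
Proof. by move=> sA; apply: sub_sigma_algebra; exists A. Qed.

Lemma borel_holds k a : borel [set M : Mod T | holds (sval M) k a].
Proof.
case: k => [[s|[f|r]]|] /=.
- case: a => [|a [|b l]]; try exact: borel_cst.
  rewrite (_ : [set _ | _] = [set M : Mod T | sort_of (sval M) a = s]).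
    apply: (@borel_subbasic [set M | sort_of M a = s]).
    by constructor 1; exists a, s.
  by apply/seteqP; split=> M /= /eqP.
- case: a => [|b a]; first exact: borel_cst.
  rewrite (_ : [set _ | _] = [set M : Mod T |
      map (sort_of (sval M)) a = fdom f /\ funI (sval M) f a = b]).
    apply: (@borel_subbasic
      [set M | map (sort_of M) a = fdom f /\ funI M f a = b]).
    by constructor 2; exists f, a, b.
  apply/seteqP; split=> M /=; first by case/andP => /eqP + /eqP.
  by case=> /eqP -> /eqP ->.
- by apply: (@borel_subbasic [set M | relI M r a]); constructor 3; exists r, a.
- by case: a => [|a [|b [|c l]]]; apply: borel_cst.
Qed.

(** A condition on one truth value is always true, always false, the fact itself or its negation. *)
Lemma borel_bool_holds (g : bool -> Prop) k a :
  borel [set M : Mod T | g (holds (sval M) k a)].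
Proof.
rewrite (_ : [set _ | _] =
  if pselect (g true) then if pselect (g false) then setT
                           else [set M : Mod T | holds (sval M) k a]
  else if pselect (g false) then ~` [set M : Mod T | holds (sval M) k a]
       else set0); last first.
  apply/seteqP; split=> M; case: pselect => gt; case: pselect => gf //=;
    by case: (holds _ _ _).
case: pselect => gt; case: pselect => gf.
- exact: (borel_cst True).
- exact: borel_holds.
- by apply: borelC; apply: borel_holds.
- exact: (borel_cst False).
Qed.

End Borel.

(** * The reduction and its Borel measurability *)

Section Reduction.
Variables (L : language) (T : set (formula L)).
Local Open Scope classical_set_scope.

Definition reduction (M : Mod T) : Mod TK :=
  exist _ (TK_of (holds (sval M)))
    (mem_set (@TK_of_models _ None (holds (sval M)))).

(** Only [pi1] depends on [M], through a label that consults a single symbol at a single tuple of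
    colours. *)
Lemma act_one_fact (f : TK_fun) (x : elt (fact L)) (y : elt (fact L)) :
  exists (g : bool -> Prop) k a,
    forall M, act (holds M) f x = y <-> g (holds M k a).
Proof.
have triv z : (forall M, act (holds M) f x = z) ->
    exists (g : bool -> Prop) k a,
      forall M, act (holds M) f x = y <-> g (holds M k a).
  by move=> E; exists (fun=> z = y), None, [::] => M; rewrite E.
case: f x triv => i [[u|c]|[[[[[k ds]|] c] j] z]] triv;
  try exact: (triv _ (fun=> erefl)); last first.
  exact: (triv (of_param None)).
by exists (fun b => of_param (if j < (pickle (k, b, map (over c) ds)).+1
  then Some (k, ds) else None) = y), k, (map color ds).
Qed.

Lemma borel_reduction : borel_map reduction.
Proof.
(* The sets with Borel preimage form a sigma-algebra, so subbasic sets suffice. *)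
have sub : @borel _ TK `<=` image_set_system setT reduction (@borel _ T).
  apply: smallest_sub.
    by apply: sigma_algebra_image; apply: smallest_sigma_algebra.
  move=> _ [A sA <-]; rewrite /image_set_system /= setTI.
  case: sA => [[a [s ->]]|[f [a [b ->]]]|[[]]].
    (* Sorts in the coding model are the same for every coded structure. *)
    have -> : reduction @^-1` [set M | sort_of (sval M) a = s] =
        [set _ | TK_sort_of (fact L) a = s] by [].
    exact: borel_cst.
  rewrite /preimage /=.
  case: (pselect (map (TK_sort_of (fact L)) a = fdom f)) => sa; last first.
    rewrite (_ : mkset _ = [set _ | False]); first exact: borel_cst.
    by apply/seteqP; split=> M //= -[].
  have [g [k [a' E]]] := act_one_fact f (dec _ (head 0 a)) (dec _ b).
  rewrite (_ : mkset _ = [set M | g (holds (sval M) k a')]).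
    exact: borel_bool_holds.
  apply/seteqP; split=> M /=; rewrite /TK_funI sa eqxx -E.
    by case=> _ <-; rewrite encK.
  by move=> ->; rewrite decK.
by move=> B /sub; rewrite /image_set_system /= setTI.
Qed.

Lemma reduction_iso (M N : Mod T) :
  iso (sval M) (sval N) <-> iso (sval (reduction M)) (sval (reduction N)).
Proof.
split=> [/iso_holds[f fbij fh]|].
  exact: iso_TK_of fbij fh.
move=> /(@iso_TK_of_inv _ _ _ None) [//|//|f fbij fh].
by apply/iso_holds; exists f.
Qed.

End Reduction.

Theorem theorem6p9 : borel_complete TK.
Proof.
move=> L Psi _; exists (@reduction L [set Psi]%classic); split.
  exact: borel_reduction.
exact: reduction_iso.
Qed.
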